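(* Let $G$ be a finite positive graph with at least one edge. Then the polytope of magic labelings of $G$, $\mathcal{P}_G$, is a rational polytope with dimension $q-n+b$, where $q$ is the number of edges of $G$, $n$ is the number of vertices, and $b$ is the number of connected components of $G$ that are bipartite. The $d$-dimensional faces of $\mathcal{P}_G$ are the $d$-dimensional polytopes of magic labelings of positive subgraphs of $G$ with $n$ vertices and at most $n-b+d$ edges.
   Context: Let $G$ be a finite graph (loops allowed) with vertices $v_1,\dots,v_n$ and $q$ edges. A labeling of $G$ assigns a nonnegative integer to each edge. A magic labeling of magic sum $r$ is a labeling such that for each vertex $v$ the sum of the labels of all edges incident to $v$ equals $r$ (a loop is counted as incident only once). Treating edge labels as real variables, the magic-sum conditions are linear equations, and the magic labelings of $G$ are the integral points of a pointed polyhedral cone $C_G \subseteq \mathbb{R}^q$ (the cone of nonnegative real edge-weightings $L$ for which all vertex sums are equal). If $e_{i_1},\dots,e_{i_{m_i}}$ denote the edges incident to $v_i$, the polytope of magic labelings of $G$ is $\mathcal{P}_G=\{L\in C_G\subseteq\mathbb{R}^q : \sum_{j=1}^{m_i} L(e_{i_j})=1,\ i=1,\dots,n\}$. A graph is positive if for every edge $e$ there is a magic labeling $L$ with $L(e)>0$. A polytope is rational if each of its vertices has rational coordinates. A face of $\mathcal{P}_G$ is a set of the form $\{L\in\mathcal{P}_G : L(e)=0 \text{ for all } e\in E_0\}$ for some subset $E_0$ of the edges; the polytope of magic labelings of a subgraph $H$ of $G$ on the same $n$ vertices is identified with the set of points of $\mathcal{P}_G$ that vanish on the edges of $G$ not in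 $H$. *)

(* Defs.v *)
From mathcomp Require Import all_boot all_order all_algebra.
From mathcomp Require Import boolp classical_sets reals.

Set Implicit Arguments.
Unset Strict Implicit.
Unset Printing Implicit Defensive.

Import Order.TTheory GRing.Theory Num.Theory.
Local Open Scope ring_scope.

(* Finite graphs with loops. [ends e] is the set of endpoints of [e], so a loop
   is an edge with a single endpoint. Parallel edges are not excluded. *)
Record graph := Graph {
  vertex : finType;
  edge : finType;
  ends : edge -> {set vertex};
  ends_card : forall e, (0 < #|ends e| <= 2)%N }.

Arguments ends {g} e.
Arguments ends_card {g} e.

Section Graphs.
Variable G : graph.

Definition adjacent : rel (vertex G) :=
  fun u v => [exists e : edge G, ends e == [set u; v]%SET].

Definition components : {set {set vertex G}} :=
  equivalence_partition (connect adjacent) [set: vertex G]%SET.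

(* A is one of the two colour classes of C. A component carrying a loop is not
   bipartite; an isolated vertex is. *)
Definition bipartite (C : {set vertex G}) : bool :=
  [exists A : {set vertex G}, (A \subset C) &&
    [forall e : edge G, (ends e \subset C) ==>
      (#|ends e :&: A| == 1%N) && (#|ends e :&: (C :\: A)| == 1%N)]].

Definition nb_bipartite : nat :=
  #|[set C in components | bipartite C]%SET|.

(* The sum ranges over sets of endpoints, so a loop counts once. *)
Definition vertex_sum (M : nmodType) (L : edge G -> M) (v : vertex G) : M :=
  \sum_(e : edge G | v \in ends e) L e.

Definition magic (r : nat) (L : edge G -> nat) : Prop :=
  forall v, vertex_sum L v = r.

Definition positive : Prop :=
  forall e : edge G, exists r (L : edge G -> nat), magic r L /\ (0 < L e)%N.

Lemma subgraph_ends_card (A : {set edge G}) (e : {e : edge G | e \in A}) :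
  (0 < #|ends (val e)| <= 2)%N.
Proof. exact: ends_card. Qed.

(* The subgraph with edge set A and the same vertices as G. *)
Definition subgraph (A : {set edge G}) : graph :=
  Graph (@subgraph_ends_card A).

End Graphs.

(* The space R^q of real edge-weightings. *)
Definition weighting (R : realType) (G : graph) := {ffun edge G -> R^o}.

Section Convexity.
Variables (R : realType) (V : vectType R).

Definition polytope (P : set V) : Prop :=
  exists (k : nat) (p : 'I_k -> V), forall x, P x <->
    exists a : 'I_k -> R, [/\ forall i, 0 <= a i,
      \sum_i a i = 1 & x = \sum_i a i *: p i].

Definition is_vertex (P : set V) (v : V) : Prop :=
  P v /\ forall (x y : V) (t : R), P x -> P y -> 0 < t < 1 ->
    v = t *: x + (1 - t) *: y -> x = v /\ y = v.

(* U is the direction of the affine hull of P: the span of P - P. *)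
Definition is_direction (P : set V) (U : {vspace V}) : Prop :=
  forall W : {vspace V},
    (U <= W)%VS <-> (forall x y, P x -> P y -> x - y \in W).

(* Affine dimension, with the convention that the empty set has dimension -1. *)
Definition has_dim (P : set V) (d : int) : Prop :=
  (P = set0 /\ d = -1) \/
  ((P !=set0)%classic /\ exists2 U, is_direction P U & d = (\dim U)%:Z).

End Convexity.

Section MagicPolytope.
Variable R : realType.

Definition rational_polytope (G : graph) (P : set (weighting R G)) : Prop :=
  polytope P /\ forall v, is_vertex P v -> forall e, rational (v e : R).

Definition magic_cone (G : graph) : set (weighting R G) :=
  [set L | (forall e, 0 <= L e) /\
           forall u v, vertex_sum L u = vertex_sum L v]%classic.

Definition magic_polytope (G : graph) : set (weighting R G) :=
  [set L | magic_cone L /\ forall v, vertex_sum L v = 1]%classic.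

Definition is_face (G : graph) (F : set (weighting R G)) : Prop :=
  exists E0 : {set edge G},
    F = [set L | magic_polytope L /\ forall e, e \in E0 -> L e = 0]%classic.

(* Extension by zero, identifying weightings of a subgraph with weightings of G
   that vanish outside it. *)
Definition zero_ext (G : graph) (A : {set edge G})
    (L : weighting R (subgraph A)) : weighting R G :=
  [ffun e => if insub e is Some e' then L e' else 0].

End MagicPolytope.

Arguments magic_polytope R G : clear implicits.

(* Main.v *)
(* The affine hull of P_G is a translate of the kernel K of the incidence map
   from edge weightings to vertex sums, because averaging magic labelings that
   are positive on the various edges yields a point of P_G all of whose
   coordinates are positive. The rank of the incidence map equals that of its
   transpose, whose kernel consists of the functions on vertices that change
   sign along every edge and so has one dimension per bipartite component.
   Moving along a direction of K supported on the support of a point until a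
   coordinate vanishes writes that point as a convex combination of points of
   smaller support; hence P_G is the hull of its finitely many points that are
   determined by their support. These solve a rational linear system with a
   unique solution, so they are rational, and clearing denominators turns them
   into magic labelings. A face is the polytope of the subgraph on the union of
   the supports of its points, to which the dimension formula applies. *)
From HB Require Import structures.
Require Import Defs.
From mathcomp Require Import all_boot all_order all_algebra.
From mathcomp Require Import boolp classical_sets reals.
From mathcomp Require Import zify.

Set Implicit Arguments.
Unset Strict Implicit.
Unset Printing Implicit Defensive.

Import Order.TTheory GRing.Theory Num.Theory.
Local Open Scope ring_scope.

(** * Rank of a relation and of its transpose *)

Section RelationSum.
Variables (R : realFieldType) (I J : finType) (r : I -> J -> bool).

(** The map given by the 0/1 matrix of [r]. With the relation as a parameter, the transpose is the
    same construction on the flipped relation. *)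
Definition rel_sum (x : {ffun I -> R^o}) : {ffun J -> R^o} :=
  [ffun j => \sum_(i | r i j) x i].

Fact rel_sum_is_linear : linear rel_sum.
Proof.
move=> a x y; apply/ffunP=> j; rewrite !ffunE scaler_sumr -big_split /=.
by apply: eq_bigr => i _; rewrite !ffunE.
Qed.

HB.instance Definition _ :=
  GRing.isLinear.Build R {ffun I -> R^o} {ffun J -> R^o} _ rel_sum
    rel_sum_is_linear.

Definition rel_hom : 'Hom({ffun I -> R^o}, {ffun J -> R^o}) := linfun rel_sum.

Lemma rel_homE (x : {ffun I -> R^o}) j : rel_hom x j = \sum_(i | r i j) x i.
Proof. by rewrite lfunE ffunE. Qed.

Lemma memv_ker_rel_hom (x : {ffun I -> R^o}) :
  reflect (forall j, \sum_(i | r i j) x i = 0) (x \in lker rel_hom).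
Proof.
rewrite memv_ker; apply: (iffP eqP) => [x0 j | x0].
  by rewrite -rel_homE x0 ffunE.
by apply/ffunP=> j; rewrite rel_homE x0 ffunE.
Qed.

Lemma dim_ffun : \dim {:{ffun I -> R^o}} = #|I|.
Proof. by rewrite dimvf /dim /= muln1. Qed.

End RelationSum.

Lemma rel_hom_adjoint (R : realFieldType) (I J : finType) (r : I -> J -> bool)
    (x : {ffun I -> R^o}) (y : {ffun J -> R^o}) :
  \sum_i rel_hom R (fun j i => r i j) y i * x i
    = \sum_j y j * rel_hom R r x j.
Proof.
transitivity (\sum_i \sum_(j | r i j) y j * x i).
  by apply: eq_bigr => i _; rewrite rel_homE mulr_suml.
rewrite (exchange_big_dep xpredT) //=; apply: eq_bigr => j _.
by rewrite rel_homE mulr_sumr.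
Qed.

(* [<T^* T x, x> = |T x|^2], so [T^* T] has the same kernel as [T]. *)
Lemma dim_limg_rel_hom_le (R : realFieldType) (I J : finType)
    (r : I -> J -> bool) :
  (\dim (limg (rel_hom R r)) <= \dim (limg (rel_hom R (fun j i => r i j))))%N.
Proof.
set f := rel_hom R r; set g := rel_hom R _.
have kerE : lker (g \o f)%VF = lker f.
  apply/vspaceP=> x; rewrite !memv_ker comp_lfunE.
  apply/eqP/eqP => [gfx0 | ->]; last by rewrite linear0.
  have := rel_hom_adjoint r x (f x); rewrite -/f -/g gfx0.
  rewrite big1 => [/esym/eqP|i _]; last by rewrite ffunE mul0r.
  rewrite psumr_eq0 => [/allP fx0|j _]; last by rewrite -expr2 sqr_ge0.
  apply/ffunP=> j; rewrite ffunE; apply/eqP.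
  by have := fx0 j (mem_index_enum _); rewrite /= mulf_eq0 orbb.
(* Equal kernels give [g \o f] and [f] the same rank, and the image of [g \o f] lies in that of
   [g]. *)
have := limg_ker_dim (g \o f)%VF fullv; rewrite kerE -(limg_ker_dim f fullv).
by move/addnI <-; rewrite limg_comp dimvS // limgS // subvf.
Qed.

(** Rank-nullity for a map and its transpose, whose ranks agree by applying the preceding inequality
    in both directions. *)
Lemma dim_lker_rel_hom (R : realFieldType) (I J : finType) (r : I -> J -> bool) :
  (\dim (lker (rel_hom R r)) + #|J|
    = #|I| + \dim (lker (rel_hom R (fun j i => r i j))))%N.
Proof.
set f := rel_hom R r; set g := rel_hom R _.
have := limg_ker_dim f fullv; rewrite capfv (dim_ffun R I) => <-.
have := limg_ker_dim g fullv; rewrite capfv (dim_ffun R J) => <-.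
have -> : \dim (limg f) = \dim (limg g).
  by apply/eqP; rewrite eqn_leq dim_limg_rel_hom_le (dim_limg_rel_hom_le R (fun j i => r i j)).
by rewrite addnAC addnA addnAC.
Qed.

(** * Bipartite components *)

Section BipartiteComponents.
Variables (G : graph).
Implicit Types (u v w : vertex G) (e : edge G) (C A : {set vertex G}).

Definition component v := finset.pblock (components G) v.

Lemma ends_nonempty e : exists v, v \in ends e.
Proof. by apply/set0Pn; rewrite -card_gt0; case/andP: (ends_card e). Qed.

Lemma ends_cases e :
  (exists v, ends e = [set v]%SET) \/
  (exists u v, u != v /\ ends e = [set u; v]%SET).
Proof.
have /andP[] := ends_card e; rewrite leq_eqVlt => /orP[|c1 c2].
  by rewrite eq_sym => /cards1P; left.
right; have /cards2P[u [v [uv ->]]] : #|ends e| == 2%N by rewrite eqn_leq c2.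
by exists u, v.
Qed.

Lemma adjacentC : symmetric (@adjacent G).
Proof.
by move=> u v; rewrite /adjacent; apply: eq_existsb => e; rewrite finset.setUC.
Qed.

Lemma connect_adjacentC : connect_sym (@adjacent G).
Proof. exact: sym_connect_sym adjacentC. Qed.

Lemma connect_adjacent_ind (P : pred (vertex G)) :
    (forall u v, adjacent u v -> P u -> P v) ->
  forall u v, connect (@adjacent G) u v -> P u -> P v.
Proof.
move=> adjP u v uv.
have clP : closed (@adjacent G) P.
  by apply: (intro_closed connect_adjacentC); exact: adjP.
by have := closed_connect clP uv; rewrite !unfold_in => ->.
Qed.

Lemma connect_equivalence :
  {in [set: vertex G]%SET & &, equivalence_rel (connect (@adjacent G))}.
Proof.
move=> u v w _ _ _; split; first exact: connect0.
by move=> uv; rewrite (same_connect connect_adjacentC uv).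
Qed.

Lemma components_partition :
  finset.partition (components G) [set: vertex G]%SET.
Proof. exact: equivalence_partitionP connect_equivalence. Qed.

Lemma mem_component u v : (v \in component u) = connect (@adjacent G) u v.
Proof.
by rewrite (pblock_equivalence_partition connect_equivalence) ?finset.in_setT.
Qed.

Lemma component_in v : component v \in components G.
Proof.
apply: finset.pblock_mem.
by rewrite (finset.cover_partition components_partition) finset.in_setT.
Qed.

Lemma component_def C v : C \in components G -> v \in C -> component v = C.
Proof. by case/and3P: components_partition => _ tI _; apply: finset.def_pblock. Qed.

Lemma component_nonempty C : C \in components G -> exists v, v \in C.
Proof.
case/and3P: components_partition => _ _ n0 CG; apply/set0Pn.
by apply: contraNneq n0 => <-.
Qed.

Lemma eq_component u v : connect (@adjacent G) u v -> component u = component v.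
Proof.
move=> uv; apply/esym; apply: component_def (component_in u) _.
by rewrite mem_component.
Qed.

Lemma ends_connect e u v :
  u \in ends e -> v \in ends e -> connect (@adjacent G) u v.
Proof.
have [-> //|uv ue ve] := eqVneq u v.
apply: connect1; apply/existsP; exists e; rewrite eq_sym eqEcard.
apply/andP; split; first by apply/fintype.subsetP=> x; rewrite !inE => /orP[]/eqP->.
by rewrite cards2 uv; case/andP: (ends_card e).
Qed.

Lemma component_ends e u v : u \in ends e -> v \in ends e ->
  component u = component v.
Proof. by move=> ue ve; apply/eq_component/(ends_connect ue ve). Qed.

Lemma ends_sub_component e v : v \in ends e -> ends e \subset component v.
Proof.
move=> ve; apply/fintype.subsetP=> u ue.
by rewrite mem_component (ends_connect ve ue).
Qed.

Definition two_colouring C A :=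
  (A \subset C) && [forall e, (ends e \subset C) ==>
    (#|ends e :&: A| == 1%N) && (#|ends e :&: (C :\: A)| == 1%N)].

(** A fixed choice of colour class. The default is reached only when [C] is not bipartite, where
    [vertex_sign] is zero anyway. *)
Definition colour_class C := odflt finset.set0 [pick A | two_colouring C A].

Lemma colour_classP C : bipartite C -> two_colouring C (colour_class C).
Proof.
rewrite /colour_class; case: pickP => //= noA /existsP[A].
by move: (noA A); rewrite /two_colouring => ->.
Qed.

Lemma card_pairI u v A : u != v ->
  #|[set u; v]%SET :&: A| = ((u \in A) + (v \in A))%N.
Proof.
move=> uv; rewrite -sum1_card; under eq_bigl do rewrite finset.in_setI.
rewrite big_mkcondr big_setU1 ?inE //= big_set1.
by case: (u \in A); case: (v \in A).
Qed.

(** * The kernel of the transposed incidence map *)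

Variable R : realFieldType.

Definition end_hom := rel_hom R (fun v e => v \in ends e).

Definition vertex_sign v : R :=
  if bipartite (component v) then
    if v \in colour_class (component v) then 1 else -1
  else 0.

Lemma vertex_sign_sqr v : bipartite (component v) -> vertex_sign v ^+ 2 = 1.
Proof. by rewrite /vertex_sign => ->; case: ifP; rewrite ?sqrrN expr1n. Qed.

Lemma sum_vertex_sign e : \sum_(v | v \in ends e) vertex_sign v = 0.
Proof.
have [[v e1]|[u [v [uv e2]]]] := ends_cases e.
  (* A loop cannot lie in a bipartite component: its single endpoint would belong both to the colour
     class and to its complement. *)
  rewrite e1 big_set1 /vertex_sign; case: ifP => // /colour_classP/andP[_].
  move=> /forallP/(_ e); rewrite ends_sub_component ?e1 ?inE //=.
  case/andP=> /eqP c1 /eqP c2.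
  have : #|([set v] :&: (component v :\: colour_class (component v)))%SET| != 0%N.
    by rewrite c2.
  have : #|([set v] :&: colour_class (component v))%SET| != 0%N by rewrite c1.
  rewrite !cards_eq0 => /set0Pn[x]; rewrite !inE => /andP[/eqP-> vA].
  by case/set0Pn=> y; rewrite !inE => /and3P[/eqP->]; rewrite vA.
have ue : u \in ends e by rewrite e2 !inE eqxx.
have ve : v \in ends e by rewrite e2 !inE eqxx orbT.
rewrite e2 big_setU1 ?inE //= big_set1 /vertex_sign (component_ends ue ve).
case: ifP => [/colour_classP/andP[_ /forallP/(_ e)]|_]; last by rewrite addr0.
rewrite ends_sub_component //= e2 card_pairI // => /andP[+ _].
by case: ifP; case: ifP; rewrite ?subrr ?addNr.
Qed.

Section Kernel.
Variable y : {ffun vertex G -> R^o}.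
Hypothesis ker_y : y \in lker end_hom.

Lemma ker_adjacent u v : adjacent u v -> y v = - y u.
Proof.
case/existsP=> e /eqP e2; have /memv_ker_rel_hom/(_ e) := ker_y.
rewrite e2; have [->|uv] := eqVneq u v.
  (* For a loop the kernel condition reads [y u = 0], which also has the required form. *)
  by rewrite finset.setUid big_set1 => ->; rewrite oppr0.
by rewrite big_setU1 ?inE //= big_set1 => /eqP; rewrite addrC addr_eq0 => /eqP.
Qed.

Lemma ker_component u v : v \in component u -> y v = y u \/ y v = - y u.
Proof.
rewrite mem_component => uv.
have : (y v == y u) || (y v == - y u).
  apply: (connect_adjacent_ind (P := fun v => (y v == y u) || (y v == - y u))) uv _.
    move=> {}v w /ker_adjacent -> /orP[]/eqP->; first by rewrite eqxx orbT.
    by rewrite opprK eqxx.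
  by rewrite eqxx.
by case/orP=> /eqP; [left|right].
Qed.

(** On the component [y] takes only the values [y v] and [- y v], which differ as [y v] is nonzero.
    Its level sets are the colour classes, and a loop would force the value zero. *)
Lemma ker_bipartite v : y v != 0 -> bipartite (component v).
Proof.
move=> yv0; have Nyv : (- y v == y v) = false.
  by apply/negbTE; rewrite eq_sym -addr_eq0 -mulr2n mulrn_eq0.
apply/existsP; exists [set w in component v | y w == y v]%SET.
apply/andP; split; first by apply/fintype.subsetP=> w; rewrite inE => /andP[].
apply/forallP=> e; apply/implyP=> /fintype.subsetP eC.
have /memv_ker_rel_hom/(_ e) := ker_y.
have [[w e1]|[u [w [uw e2]]]] := ends_cases e.
  have wC : w \in component v by apply: eC; rewrite e1 inE.
  rewrite e1 big_set1 => yw0; case: (ker_component wC); rewrite yw0.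
    by move/eqP; rewrite eq_sym (negbTE yv0).
  by move/eqP; rewrite eq_sym oppr_eq0 (negbTE yv0).
have uC : u \in component v by apply: eC; rewrite e2 !inE eqxx.
have wC : w \in component v by apply: eC; rewrite e2 !inE eqxx orbT.
rewrite e2 big_setU1 ?inE //= big_set1 => /eqP; rewrite addr_eq0 => /eqP yu.
rewrite !card_pairI // !inE uC wC /= !andbT yu.
by have [->|->] := ker_component wC; rewrite ?opprK eqxx Nyv.
Qed.

End Kernel.

Lemma sign_in_ker : [ffun v => vertex_sign v : R^o] \in lker end_hom.
Proof.
apply/memv_ker_rel_hom=> e; rewrite -[RHS](sum_vertex_sign e).
by apply: eq_bigr => v _; rewrite ffunE.
Qed.

(** Both factors change sign along every edge, so their product is constant on a component. *)
Lemma ker_sign_component (y : {ffun vertex G -> R^o}) u v :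
    y \in lker end_hom -> v \in component u ->
  vertex_sign v * y v = vertex_sign u * y u.
Proof.
move=> ker_y; rewrite mem_component => uv; apply/eqP.
apply: (connect_adjacent_ind
  (P := fun v => vertex_sign v * y v == vertex_sign u * y u)) uv _ => //.
move=> {}v w vw /eqP <-; rewrite (ker_adjacent ker_y vw).
by have := ker_adjacent sign_in_ker vw; rewrite !ffunE => ->; rewrite mulrNN.
Qed.

Definition bipartite_component :=
  {C : {set vertex G} | C \in [set C in components G | bipartite C]%SET}.

(** An explicit parametrization of the kernel by one scalar per bipartite component. On the other
    components [vertex_sign] vanishes, so the default value is harmless. *)
Definition spread (c : {ffun bipartite_component -> R^o}) :
    {ffun vertex G -> R^o} :=
  [ffun v => vertex_sign v *
             (if insub (component v) is Some C then c C else 0)].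

Fact spread_is_linear : linear spread.
Proof.
move=> a c d; apply/ffunP=> v; rewrite !ffunE; case: insub => [C|].
  by rewrite !ffunE mulrDr scalerAr.
by rewrite !mulr0 scaler0 addr0.
Qed.

HB.instance Definition _ :=
  GRing.isLinear.Build R {ffun bipartite_component -> R^o}
    {ffun vertex G -> R^o} _ spread spread_is_linear.

Lemma spread_injective : injective (linfun spread).
Proof.
apply/lker0P; rewrite -subv0; apply/subvP=> c; rewrite memv_ker memv0.
move=> /eqP c0; apply/eqP/ffunP=> C; rewrite ffunE.
have := valP C; rewrite inE => /andP[CG Cbip].
have [v vC] := component_nonempty CG; have vE := component_def CG vC.
have : spread c v = 0 by rewrite -[spread c]lfunE c0 ffunE.
rewrite ffunE vE valK => /eqP; rewrite mulf_eq0 => /orP[/eqP s0|/eqP //].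
have := @vertex_sign_sqr v; rewrite vE s0 expr0n /= => /(_ Cbip)/esym/eqP.
by rewrite oner_eq0.
Qed.

Lemma limg_spread : limg (linfun spread) = lker end_hom.
Proof.
apply/eqP; rewrite eqEsubv; apply/andP; split; apply/subvP=> y.
  case/memv_imgP=> c _ ->; apply/memv_ker_rel_hom=> e.
  have [v0 v0e] := ends_nonempty e.
  under eq_bigr => v ve do rewrite lfunE ffunE (component_ends ve v0e).
  by rewrite -mulr_suml sum_vertex_sign mul0r.
move=> ker_y; apply/memv_imgP.
(* The signed value of [y] does not depend on the vertex picked, by [ker_sign_component]; components
   are nonempty, so the default never occurs. *)
pose c : {ffun bipartite_component -> R^o} := [ffun C : bipartite_component =>
  (if [pick v in val C] is Some v then vertex_sign v * y v else 0) : R^o].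
exists c; first exact: memvf.
apply/ffunP=> v; rewrite lfunE ffunE.
have [bip|nbip] := boolP (bipartite (component v)); last first.
  rewrite /vertex_sign (negbTE nbip) mul0r; apply/eqP.
  by apply: contraNT nbip => /(ker_bipartite ker_y).
have vB : component v \in [set C in components G | bipartite C]%SET.
  by rewrite inE component_in.
case: insubP => [C _ EC|]; last by rewrite vB.
rewrite ffunE EC; case: pickP => [w /= wC|/(_ v)]; last first.
  by rewrite mem_component connect0.
rewrite (ker_sign_component ker_y wC) mulrA -expr2 vertex_sign_sqr //.
by rewrite mul1r.
Qed.

Lemma dim_lker_end_hom : \dim (lker end_hom) = nb_bipartite G.
Proof.
rewrite -limg_spread limg_dim_eq; last first.
  by rewrite (eqP (introT lker0P spread_injective)) capv0.
by rewrite dim_ffun card_sig; apply: eq_card => C; rewrite !inE.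
Qed.

End BipartiteComponents.

(** * Extremal points of the magic polytope *)

Section MagicPoints.
Variables (R : realType) (G : graph).
Notation W := {ffun edge G -> R^o}.
Implicit Types (x y k : W) (e : edge G) (v : vertex G).

Definition incidence_hom := rel_hom R (fun (e : edge G) v => v \in ends e).

Lemma magic_polytopeP x :
  magic_polytope R G x <-> (forall e, 0 <= x e) /\ forall v, vertex_sum x v = 1.
Proof.
split=> [[[x0 _] x1]|[x0 x1]]; first by split.
by split=> //; split=> // u v; rewrite !x1.
Qed.

Lemma vertex_sum_comb (a b : R) x y v :
  vertex_sum (a *: x + b *: y) v = a * vertex_sum x v + b * vertex_sum y v.
Proof.
rewrite /vertex_sum !mulr_sumr -big_split /=.
by apply: eq_bigr => e _; rewrite !ffunE.
Qed.

Lemma ker_incidenceP k :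
  reflect (forall v, vertex_sum k v = 0) (k \in lker incidence_hom).
Proof. exact: memv_ker_rel_hom. Qed.

Lemma magic_polytope_sub_ker x y :
  magic_polytope R G x -> magic_polytope R G y -> x - y \in lker incidence_hom.
Proof.
move=> /magic_polytopeP[_ x1] /magic_polytopeP[_ y1]; apply/ker_incidenceP => v.
have -> : x - y = 1 *: x + (- 1) *: y by rewrite scale1r scaleN1r.
by rewrite vertex_sum_comb x1 y1 !mulr1 subrr.
Qed.

Lemma magic_polytope_add x k :
    magic_polytope R G x -> k \in lker incidence_hom ->
    (forall e, 0 <= x e + k e) -> magic_polytope R G (x + k).
Proof.
move=> /magic_polytopeP[_ x1] /ker_incidenceP k0 xk0.
apply/magic_polytopeP; split=> [e|v]; first by rewrite ffunE.
rewrite -[x]scale1r -[k]scale1r vertex_sum_comb x1 k0.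
by rewrite mulr1 mulr0 addr0.
Qed.

Definition support_set x := [set e | x e != 0]%SET.

(** A nonnegative [k] with zero vertex sums vanishes on every edge, since every edge has an
    endpoint. This is what makes the polytope bounded. *)
Lemma ker_has_negative k :
  k \in lker incidence_hom -> k != 0 -> exists e, k e < 0.
Proof.
move=> /memv_ker_rel_hom ker_k k0; apply/existsP; apply: contraNT k0.
rewrite negb_exists => /forallP kge0; apply/eqP/ffunP=> e; rewrite ffunE.
have [v ve] := ends_nonempty e.
have /eqP := ker_k v; rewrite psumr_eq0 => [|i _]; last by rewrite leNgt kge0.
by move=> /allP/(_ e (mem_index_enum _)); rewrite ve => /eqP.
Qed.

(* Move along [k] until the first coordinate vanishes. *)
Lemma magic_push x k :
    magic_polytope R G x -> k \in lker incidence_hom -> k != 0 ->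
    (forall e, x e = 0 -> k e = 0) ->
  exists t : R, [/\ 0 < t, magic_polytope R G (x + t *: k)
                    & support_set (x + t *: k) \proper support_set x].
Proof.
move=> Px ker_k k0 kx; have [e0 ke0] := ker_has_negative ker_k k0.
have [x0 _] := (magic_polytopeP x).1 Px.
case: (arg_minP (P := fun e => k e < 0) (fun e => x e / - k e) ke0) => e1 ke1 min.
set t := x e1 / - k e1 in min.
have xe1 : x e1 != 0.
  by apply/eqP => /kx ke; rewrite ke ltxx in ke1.
have t0 : 0 < t by rewrite divr_gt0 ?oppr_gt0 // lt_def xe1 x0.
exists t; split=> //.
  apply: magic_polytope_add => // [|e]; first by rewrite memvZ.
  rewrite ffunE; have [ke|ke] := leP 0 (k e).
    by rewrite addr_ge0 // mulr_ge0 // ltW.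
  have := min e ke; rewrite ler_pdivlMr ?oppr_gt0 //.
  by rewrite mulrN -subr_ge0 opprK.
apply/properP; split.
  apply/fintype.subsetP=> e; rewrite !inE !ffunE; apply: contraNneq => xe.
  by rewrite xe kx // scaler0 addr0.
exists e1; rewrite !inE // !ffunE /GRing.scale /= negbK.
have ke1' : k e1 != 0 by rewrite lt_eqF.
by rewrite /t invrN mulrN mulNr divfK // subrr.
Qed.

(** Extremality as a linear condition, so that it can be used with linear systems over the
    rationals: no nonzero kernel direction lives on the support of [x]. *)
Definition extremal x := magic_polytope R G x /\
  forall k, k \in lker incidence_hom -> (forall e, x e = 0 -> k e = 0) -> k = 0.

Lemma magic_segment x : magic_polytope R G x -> ~ extremal x ->
  exists y z (t : R), [/\ magic_polytope R G y /\ magic_polytope R G z,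
    support_set y \proper support_set x, support_set z \proper support_set x,
    0 < t < 1 & x = t *: y + (1 - t) *: z].
Proof.
move=> Px not_ext; have [k [ker_k kx k0]] : exists k,
    [/\ k \in lker incidence_hom, forall e, x e = 0 -> k e = 0 & k != 0].
  apply: contrapT => nok; apply: not_ext; split=> // k ker_k kx.
  by apply/eqP; apply: contrapT => /negP k0; apply: nok; exists k.
have [t [t0 Pt st]] := magic_push Px ker_k k0 kx.
have Nk0 : - k != 0 by rewrite oppr_eq0.
have kxN e : x e = 0 -> (- k) e = 0 by move/kx=> ke; rewrite ffunE ke oppr0.
have [|s [s0 Ps ss]] := magic_push Px _ Nk0 kxN; first by rewrite memvN.
have ts0 : 0 < t + s by rewrite addr_gt0.
(* The weights [s / (t + s)] and [t / (t + s)] make the two displacements along [k] cancel. *)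
exists (x + t *: k), (x + s *: - k), (s / (t + s)); split=> //.
  rewrite divr_gt0 //= ltr_pdivrMr // mul1r ltrDr //.
have -> : 1 - s / (t + s) = t / (t + s).
  by rewrite -{1}(divff (lt0r_neq0 ts0)) -mulrBl addrK.
have stE : s / (t + s) * t = t / (t + s) * s.
  by rewrite mulrAC [RHS]mulrAC [s * t]mulrC.
rewrite !scalerDr !scalerA addrACA -scalerDl -mulrDl stE scalerN subrr addr0.
by rewrite [s + t]addrC divff ?lt0r_neq0 // scale1r.
Qed.

(** The statement that the polytope is the hull of its extremal points, cast as an induction
    principle; the recursion is on the size of the support. *)
Lemma magic_ind (Q : W -> Prop) :
    (forall x, extremal x -> Q x) ->
    (forall x y (t : R), 0 < t < 1 -> Q x -> Q y -> Q (t *: x + (1 - t) *: y)) ->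
  forall x, magic_polytope R G x -> Q x.
Proof.
move=> Qext Qconv x.
have [n] := ubnP #|support_set x|; elim: n x => // n IHn x; rewrite ltnS => xn Px.
have [/Qext //|/(magic_segment Px)[y [z [t [[Py Pz] sy sz t01 ->]]]]] := pselect (extremal x).
by apply: Qconv => //; apply: IHn => //; apply: leq_trans xn; apply: proper_card.
Qed.

Lemma extremal_unique x y : extremal x -> magic_polytope R G y ->
  (forall e, x e = 0 -> y e = 0) -> y = x.
Proof.
move=> [Px ext] Py yx; apply/eqP; rewrite -subr_eq0; apply/eqP/ext.
  exact: magic_polytope_sub_ker.
by move=> e xe; rewrite !ffunE yx // xe subr0.
Qed.

(** Otherwise [magic_segment] puts [x] strictly between two points of smaller support, hence
    different from [x]. *)
Lemma vertex_extremal x : is_vertex (magic_polytope R G) x -> extremal x.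
Proof.
case=> Px vert; apply: contrapT => /(magic_segment Px)[y [z [t [[Py Pz] sy _ t01 xE]]]].
by have [yx _] := vert y z t Py Pz t01 xE; rewrite yx fintype.properxx in sy.
Qed.

End MagicPoints.

(** * Rationality and integrality *)

Section Rationality.
Variables (R : realType) (G : graph).
Notation W := {ffun edge G -> R^o}.
Implicit Types (x y k : W) (e : edge G) (v : vertex G).

(* A linear system over the rationals that is solvable over the reals is
   solvable over the rationals; the solution supported on the support of an
   extremal point is unique, hence rational. *)
Lemma extremal_rational x e : extremal x -> rational (x e : R).
Proof.
move=> ext; have [Px ext_ker] := ext.
have [_ x1] := (magic_polytopeP x).1 Px.
(* The incidence matrix with the rows of edges outside the support of [x] set to zero. *)
pose N : 'M[rat]_(#|edge G|, #|vertex G|) := \matrix_(i, j)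
  ((x (enum_val i) != 0) && (enum_val j \in ends (enum_val i)))%:R.
pose X : 'rV[R]_#|edge G| := \row_i x (enum_val i).
have XN : X *m map_mx ratr N = map_mx ratr (const_mx 1).
  apply/rowP=> j; rewrite !mxE rmorph1 -[RHS](x1 (enum_val j)) /vertex_sum.
  rewrite [RHS]big_mkcond [RHS]big_enum_val /=; apply: eq_bigr => i _.
  rewrite !mxE ratr_nat; case: (x _ =P 0) => [->|_] /=.
    by rewrite mul0r if_same.
  by case: ifP; rewrite ?mulr1 ?mulr0.
have : (map_mx (@ratr R) (const_mx 1 : 'rV_#|vertex G|) <= map_mx ratr N)%MS.
  by rewrite -XN submxMl.
(* Row-space membership is unchanged by field extension, which yields the rational solution [D]. *)
rewrite map_submx => /submxP[D DN].
(* [N] leaves [D] unconstrained outside the support of [x], so those coordinates are cut to zero. *)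
pose y : W := [ffun e => (if x e != 0 then ratr (D 0 (enum_rank e)) else 0) : R^o].
suff yx : y = x.
  rewrite -yx ffunE; case: ifP => _; first by exists (D 0 (enum_rank e)).
  by exists 0; rewrite // rmorph0.
apply/eqP; rewrite -subr_eq0; apply/eqP/ext_ker; last first.
  by move=> f xf; rewrite !ffunE xf eqxx subr0.
apply/ker_incidenceP=> v.
have -> : y - x = 1 *: y + (- 1) *: x by rewrite scale1r scaleN1r.
rewrite vertex_sum_comb x1 mul1r mulr1; apply/eqP; rewrite subr_eq0; apply/eqP.
have := congr1 (fun M : 'rV_#|vertex G| => M 0 (enum_rank v)) DN; rewrite !mxE.
move/(congr1 (@ratr R)); rewrite rmorph1 rmorph_sum => ->.
rewrite /vertex_sum [LHS]big_mkcond [LHS]big_enum_val /=; apply: eq_bigr => i _.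
rewrite !mxE enum_rankK rmorphM rmorph_nat ffunE enum_valK.
by case: (x _ =P 0) => _ /=; case: ifP; rewrite ?mulr1 ?mulr0.
Qed.

Lemma clear_denominators (I : finType) (q : I -> rat) :
    (forall i, 0 <= q i) ->
  exists2 d : nat, (0 < d)%N & exists m : I -> nat, forall i, (m i)%:R = q i * d%:R.
Proof.
move=> q0; exists (\prod_i `|denq (q i)|)%N.
  by rewrite prodn_gt0 // => i; rewrite absz_gt0 denq_neq0.
exists (fun i => `|numq (q i)| * \prod_(j | j != i) `|denq (q j)|)%N => i.
rewrite [in RHS](bigD1 i) //= !natrM mulrA; congr (_ * _).
have natE (z : int) : 0 <= z -> (`|z|%N%:R : rat) = z%:~R.
  by move=> z0; rewrite -[z in RHS]gez0_abs.
rewrite !natE ?numq_ge0 ?denq_ge0 //.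
by rewrite -{2}[q i]divq_num_den divfK // intr_eq0 denq_neq0.
Qed.

Lemma rational_point_magic x :
    magic_polytope R G x -> (forall e, rational (x e : R)) ->
  exists r (L : edge G -> nat), magic r L /\ forall e, 0 < x e -> (0 < L e)%N.
Proof.
move=> /magic_polytopeP[x0 x1] xQ.
have /choice[q qE] : forall e, exists q : rat, ratr q = x e :> R.
  by move=> e; have [q _ qE] := xQ e; exists q.
have [|d d0 [L LE]] := @clear_denominators _ q.
  by move=> e; rewrite -(ler0q R) qE.
(* The vertex sums of [x] equal 1, so the common denominator [d] becomes the magic sum. *)
exists d, L; split=> [v|e xe]; last first.
  by rewrite -(ltr0n rat) LE mulr_gt0 ?ltr0n // -(ltr0q R) qE.
have q1 : \sum_(e : edge G | v \in ends e) q e = 1.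
  apply: (fmorph_inj (@ratr R)); rewrite rmorph_sum rmorph1 -[RHS](x1 v).
  by rewrite /vertex_sum; apply: eq_bigr => e _; apply: qE.
apply/eqP; rewrite -(eqr_nat rat) /vertex_sum.
have -> : \sum_(e | v \in ends e) L e = (\sum_(e | v \in ends e) L e)%N by [].
rewrite natr_sum; under eq_bigr do rewrite LE.
by rewrite -mulr_suml q1 mul1r.
Qed.

(** A labeling is scaled down by its magic sum. Conversely, a real point positive at [e] forces an
    extremal point positive at [e], which is rational and can be scaled up. *)
Lemma positiveP :
  positive G <-> forall e, exists2 x : W, magic_polytope R G x & 0 < x e.
Proof.
split=> [Gpos e|Gpos e]; last first.
  have [x Px xe] := Gpos e.
  have : exists2 y : W, extremal y & 0 < y e.
    move: x Px xe; apply: magic_ind => [x ext xe|x y t]; first by exists x.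
    move=> /andP[t0 t1] IHx IHy; rewrite !ffunE /GRing.scale /=.
    (* A convex combination positive at [e] has at least one term positive at [e]. *)
    have [/IHx //|xe] := ltP 0 (x e); have [/IHy //|ye] := ltP 0 (y e).
    rewrite ltNge -oppr_ge0 opprD -!mulrN addr_ge0 // mulr_ge0 ?oppr_ge0 //.
      exact: ltW.
    by rewrite subr_ge0 ltW.
  case=> y ext ye.
  have [//|f|r [L [magicL Lpos]]] := @rational_point_magic y _ _.
  - exact: ext.1.
  - exact: extremal_rational.
  by exists r, L; split=> //; apply: Lpos.
have [r [L [magicL Le]]] := Gpos e.
have [v ve] := ends_nonempty e.
have natrL w : \sum_(f | w \in ends f) (L f)%:R = r%:R :> R.
  by rewrite -natr_sum -[in RHS](magicL w).
have r0 : 0 < r%:R :> R.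
  rewrite -(natrL v) (bigD1 e) //= ltr_pwDl ?ltr0n //.
  by apply: sumr_ge0 => f _; apply: ler0n.
exists [ffun f => ((L f)%:R / r%:R) : R^o]; last by rewrite ffunE divr_gt0 // ltr0n.
apply/magic_polytopeP; split=> [f|w]; first by rewrite ffunE divr_ge0 ?ler0n.
rewrite /vertex_sum; under eq_bigr do rewrite ffunE.
by rewrite -mulr_suml natrL divff ?lt0r_neq0.
Qed.

(** The average, over all edges [f], of points positive at [f]; having an edge makes the divisor
    nonzero. *)
Lemma positive_interior : positive G -> (0 < #|edge G|)%N ->
  exists2 x : W, magic_polytope R G x & forall e, 0 < x e.
Proof.
move=> /positiveP Gpos q0.
have /choice[p pP] : forall e, exists x : W, magic_polytope R G x /\ 0 < x e.
  by move=> e; have [x] := Gpos e; exists x.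
have q0' : 0 < #|edge G|%:R :> R by rewrite ltr0n.
have p0 e f : 0 <= p f e.
  by have [/magic_polytopeP[]] := pP f.
exists [ffun e => (\sum_f p f e) / #|edge G|%:R : R^o] => [|e]; last first.
  rewrite ffunE divr_gt0 // (bigD1 e) //= ltr_pwDl ?(pP e).2 //.
  exact: sumr_ge0.
apply/magic_polytopeP; split=> [e|v].
  by rewrite ffunE divr_ge0 ?ler0n // sumr_ge0.
rewrite /vertex_sum; under eq_bigr do rewrite ffunE.
rewrite -mulr_suml exchange_big /= (eq_bigr (fun=> 1)) => [|f _].
  by rewrite sumr_const divff ?lt0r_neq0.
by have [/magic_polytopeP[_ p1] _] := pP f; apply: p1.
Qed.

(** The generators are indexed by all edge sets, since an extremal point is determined by its
    support. Sets that support no extremal point receive the filler [x0], which adds nothing to the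
    hull. *)
Lemma polytope_magic x0 : magic_polytope R G x0 -> polytope (magic_polytope R G).
Proof.
move=> P0.
pose good (S : {set edge G}) (y : W) := extremal y /\ support_set y = S.
have /choice[p pP] : forall S : {set edge G}, exists y : W,
    magic_polytope R G y /\ forall z, good S z -> z = y.
  move=> S; have [[y [ext yS]]|noz] := pselect (exists y, good S y).
    exists y; split=> [|z [[Pz _] zS]]; first exact: ext.1.
    apply: (extremal_unique ext Pz) => e ye; apply/eqP; apply: contraT => ze.
    have : e \notin support_set y by rewrite inE ye eqxx.
    by rewrite yS -zS inE ze.
  by exists x0; split=> // z gz; case: noz; exists z.
exists #|{: {set edge G}}|, (fun i => p (enum_val i)) => x; split.
  move: x; apply: magic_ind => [x ext|x y t /andP[t0 t1] [a [a0 a1 ->]] [b [b0 b1 ->]]].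
    exists (fun i => (i == enum_rank (support_set x))%:R); split.
    - by move=> i; apply: ler0n.
    - rewrite (bigD1 (enum_rank (support_set x))) //= eqxx big1 ?addr0 // => i.
      by move/negbTE->.
    rewrite (bigD1 (enum_rank (support_set x))) //= eqxx scale1r enum_rankK.
    rewrite big1 ?addr0 => [|i /negbTE->]; last by rewrite scale0r.
    by apply: (pP _).2.
  exists (fun i => t * a i + (1 - t) * b i); split.
  - by move=> i; rewrite addr_ge0 // mulr_ge0 ?subr_ge0 // ltW.
  - by rewrite big_split /= -!mulr_sumr a1 b1 !mulr1 addrC subrK.
  rewrite !scaler_sumr -big_split /=; apply: eq_bigr => i _.
  by rewrite !scalerA -scalerDl.
case=> a [a0 a1 ->].
have sumE e : (\sum_i a i *: p (enum_val i)) e = \sum_i a i * p (enum_val i) e.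
  by rewrite sum_ffunE; apply: eq_bigr => i _; rewrite ffunE.
apply/magic_polytopeP; split=> [e|v].
  rewrite sumE; apply: sumr_ge0 => i _; rewrite mulr_ge0 //.
  by have [/magic_polytopeP[]] := pP (enum_val i).
rewrite /vertex_sum; under eq_bigr do rewrite sumE.
rewrite exchange_big /= -[RHS]a1; apply: eq_bigr => i _.
rewrite -mulr_sumr; have [/magic_polytopeP[_ p1] _] := pP (enum_val i).
by rewrite -[RHS]mulr1 -(p1 v).
Qed.

End Rationality.

(** * Dimension and faces *)

Section Dimension.
Variable R : realType.

(** The universal property in [is_direction] determines the subspace, by testing each candidate
    against the other. *)
Lemma has_dim_unique (V : vectType R) (P : set V) (d d' : int) :
  has_dim P d -> has_dim P d' -> d = d'.
Proof.
case=> [[P0 ->]|[[x Px] [U dirU ->]]].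
  by case=> [[_ ->]//|[[y]]]; rewrite P0.
case=> [[P0]|[_ [U' dirU' ->]]]; first by rewrite P0 in Px.
suff -> : U = U' by [].
apply/eqP; rewrite eqEsubv; apply/andP; split.
  by apply/(dirU U')/(dirU' U').
by apply/(dirU' U)/(dirU U).
Qed.

Lemma has_dim_limg (V V' : vectType R) (f : 'Hom(V, V')) (P : set V) (d : int) :
  injective f -> has_dim P d -> has_dim (f @` P)%classic d.
Proof.
move=> f_inj [[-> ->]|[P0 [U dirU ->]]]; first by left; rewrite image_set0.
right; split; first by case: P0 => x Px; exists (f x), x.
exists (f @: U)%VS; last first.
  by rewrite limg_dim_eq // (eqP (introT lker0P f_inj)) capv0.
(* The adjunction between image and preimage carries the universal property of [U] over to
   [f @: U]. *)
have preimE W : (f @: U <= W)%VS = (U <= f @^-1: W)%VS.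
  apply/subvP/subvP => [UW u Uu|UW _ /memv_imgP[u Uu ->]].
    by rewrite -memv_preim UW // memv_img.
  by rewrite memv_preim UW.
move=> W; rewrite preimE; split.
  move=> /(dirU (f @^-1: W)%VS) UW _ _ [x Px <-] [y Py <-].
  by rewrite -linearB memv_preim UW.
move=> PW; apply/(dirU (f @^-1: W)%VS) => x y Px Py.
by rewrite -memv_preim linearB PW //; [exists x|exists y].
Qed.

(** From a point with all coordinates positive one can move along any kernel direction, so each is a
    multiple of a difference of two points. *)
Lemma magic_direction (G : graph) (x : weighting R G) :
    magic_polytope R G x -> (forall e, 0 < x e) ->
  is_direction (magic_polytope R G) (lker (incidence_hom R G)).
Proof.
move=> Px x0 W; split=> [/subvP KW y z Py Pz|PW].
  by apply/KW/magic_polytope_sub_ker.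
apply/subvP=> k ker_k; have [->|k0] := eqVneq k 0; first exact: mem0v.
have [|t [t0 Pt _]] := magic_push Px ker_k k0.
  by move=> e xe; have := x0 e; rewrite xe ltxx.
have := PW _ _ Pt Px; rewrite addrC addKr => tkW.
by rewrite -[k]scale1r -(mulVf (lt0r_neq0 t0)) -scalerA memvZ.
Qed.

(** Stated with a kernel dimension in place of [nb_bipartite], because these kernels compare
    directly between a graph and its subgraphs. *)
Lemma has_dim_magic (G : graph) : positive G -> (0 < #|edge G|)%N ->
  has_dim (magic_polytope R G)
    (#|edge G|%:Z - #|vertex G|%:Z + (\dim (lker (end_hom G R)))%:Z).
Proof.
move=> Gpos q0; have [x Px x0] := positive_interior R Gpos q0.
right; split; first by exists x.
exists (lker (incidence_hom R G)); first exact: magic_direction Px x0.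
have := dim_lker_rel_hom R (fun (e : edge G) v => v \in ends e).
move/(congr1 Posz); rewrite !PoszD => kerE.
apply/eqP; rewrite addrAC subr_eq; apply/eqP; symmetry; exact: kerE.
Qed.

Lemma magic_polytope_edgeless (G : graph) :
  (0 < #|vertex G|)%N -> #|edge G| = 0%N -> magic_polytope R G = set0.
Proof.
move=> /card_gt0P[v _] /card0_eq q0; apply/seteqP; split=> // x /magic_polytopeP[_ /(_ v)].
rewrite /vertex_sum big1 => [/esym/eqP|e _]; first by rewrite oner_eq0.
by have := q0 e; rewrite inE.
Qed.

(** The constant function 1 is not in the kernel: its sum over an edge counts the endpoints. This
    provides the edge bound for the empty face. *)
Lemma dim_lker_end_hom_lt (G : graph) : (0 < #|edge G|)%N ->
  (\dim (lker (end_hom G R)) < #|vertex G|)%N.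
Proof.
move=> /card_gt0P[e _]; rewrite ltnNge -(dim_ffun R (vertex G)).
apply/negP=> le_dim; have : [ffun=> 1 : R^o] \in lker (end_hom G R).
  have /eqP -> : lker (end_hom G R) == fullv by rewrite eqEdim subvf.
  exact: memvf.
move/memv_ker_rel_hom/(_ e); under eq_bigr do rewrite ffunE.
rewrite sumr_const => /eqP; rewrite pnatr_eq0 => /eqP c0.
by have := ends_card e; rewrite c0.
Qed.

(** * Subgraphs and extension by zero *)

Section Subgraph.
Variables (G : graph) (A : {set edge G}).
Notation H := (subgraph A).

Fact zero_ext_is_linear : linear (@zero_ext R G A : weighting R H -> weighting R G).
Proof.
move=> a x y; apply/ffunP=> e; rewrite !ffunE; case: insub => [f|].
  by rewrite !ffunE.
by rewrite scaler0 addr0.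
Qed.

HB.instance Definition _ :=
  GRing.isLinear.Build R {ffun edge H -> R^o} {ffun edge G -> R^o} _
    (@zero_ext R G A) zero_ext_is_linear.

Definition zero_ext_hom : 'Hom({ffun edge H -> R^o}, {ffun edge G -> R^o}) :=
  linfun (@zero_ext R G A).

Lemma zero_ext_val (x : weighting R H) (e : edge H) : zero_ext x (val e) = x e.
Proof. by rewrite ffunE valK. Qed.

Lemma zero_ext_notin (x : weighting R H) e : e \notin A -> zero_ext x e = 0.
Proof. by move=> eA; rewrite ffunE insubN. Qed.

Lemma zero_ext_inj : injective (@zero_ext R G A).
Proof.
by move=> x y xy; apply/ffunP=> e; rewrite -!zero_ext_val xy.
Qed.

Lemma has_dim_zero_ext (P : set (weighting R H)) (d : int) :
  has_dim P d -> has_dim (@zero_ext R G A @` P)%classic d.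
Proof.
have zeroE : zero_ext_hom =1 @zero_ext R G A by move=> x; rewrite lfunE.
have -> : (@zero_ext R G A @` P)%classic = (zero_ext_hom @` P)%classic.
  by congr image; apply/funext => x; rewrite zeroE.
by apply: has_dim_limg => x y; rewrite !zeroE; apply: zero_ext_inj.
Qed.

Lemma vertex_sum_zero_ext (x : weighting R H) v :
  vertex_sum (zero_ext x) v = vertex_sum x v.
Proof.
rewrite /vertex_sum (bigID (mem A)) /= [X in _ + X]big1 ?addr0; last first.
  by move=> e /andP[_ eA]; rewrite zero_ext_notin.
under eq_bigl do rewrite andbC.
by rewrite big_sub_cond; apply: eq_bigr => e _; rewrite zero_ext_val.
Qed.

Lemma zero_ext_image :
  (@zero_ext R G A @` magic_polytope R H)%classic =
  [set L | magic_polytope R G L /\ forall e, e \in (~: A)%SET -> L e = 0]%classic.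
Proof.
apply/seteqP; split=> [_ [x /magic_polytopeP[x0 x1] <-]|L [/magic_polytopeP[L0 L1] LA]].
  split=> [|e]; last by rewrite inE; apply: zero_ext_notin.
  apply/magic_polytopeP; split=> [e|v]; last by rewrite vertex_sum_zero_ext x1.
  by rewrite ffunE; case: insub.
pose x : weighting R H := [ffun e => L (val e)].
have xL : zero_ext x = L.
  apply/ffunP=> e; have [eA|eA] := boolP (e \in A).
    by have := zero_ext_val x (exist _ e eA); rewrite [x _]ffunE.
  by rewrite zero_ext_notin // LA // inE.
exists x => //; apply/magic_polytopeP; split=> [e|v]; first by rewrite ffunE.
by rewrite -vertex_sum_zero_ext xL L1.
Qed.

(** Fewer edges impose fewer sign conditions on vertex functions. *)
Lemma lker_end_hom_subgraph :
  (\dim (lker (end_hom G R)) <= \dim (lker (end_hom H R)))%N.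
Proof.
apply: dimvS; apply/subvP=> y /memv_ker_rel_hom ker_y.
by apply/memv_ker_rel_hom=> e; apply: ker_y (val e).
Qed.

End Subgraph.
End Dimension.

Theorem theorem1p6 (R : realType) (G : graph)
    (G_positive : positive G) (G_edge : (0 < #|edge G|)%N) :
  let q : int := #|edge G|%:Z in
  let n : int := #|vertex G|%:Z in
  let b : int := (nb_bipartite G)%:Z in
  [/\ rational_polytope (magic_polytope R G),
      has_dim (magic_polytope R G) (q - n + b) &
      forall (d : int) (F : set (weighting R G)),
        (is_face F /\ has_dim F d) <->
        (exists A : {set edge G},
          [/\ positive (subgraph A),
              #|edge (subgraph A)|%:Z <= n - b + d,
              has_dim (magic_polytope R (subgraph A)) d &
              F = (@zero_ext R G A @` magic_polytope R (subgraph A))%classic])].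
Proof.
move=> q n b; have bE : b = (\dim (lker (end_hom G R)))%:Z.
  by rewrite dim_lker_end_hom.
have [x0 Px0 _] := positive_interior R G_positive G_edge.
split.
- split; first exact: polytope_magic Px0.
  by move=> v /vertex_extremal ext e; apply: extremal_rational.
- by rewrite bE; apply: has_dim_magic.
move=> d F; split; last first.
  case=> A [_ _ dimA FE]; rewrite FE; split; last exact: has_dim_zero_ext.
  by exists (~: A)%SET; apply: zero_ext_image.
case=> -[E0 FE] dimF.
(* The union of the supports of the points of [F]. The complement of [E0] could be too large: an
   edge outside [E0] may still vanish on all of [F], which would spoil positivity. *)
pose A := [set e | `[< exists2 L, F L & L e != 0 >]]%SET.
have FA : F = (@zero_ext R G A @` magic_polytope R (subgraph A))%classic.
  rewrite zero_ext_image; apply/seteqP; split=> [L FL|L [PL LA]].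
    split=> [|e]; first by move: FL; rewrite FE => -[].
    rewrite !inE => /asboolPn eA; apply/eqP; apply: contraT => Le.
    by case: eA; exists L.
  rewrite FE; split=> // e eE0; apply: LA; rewrite !inE; apply/asboolPn.
  by case=> L'; rewrite FE => -[_ L'0]; rewrite L'0 ?eqxx.
have Apos : positive (subgraph A).
  apply/(positiveP R) => e.
  have := valP e; rewrite inE => /asboolP[L]; rewrite {1}FA => -[x Px <-].
  rewrite zero_ext_val => xe; exists x => //.
  by rewrite lt_def xe; have [->] := (magic_polytopeP x).1 Px.
have [e _] := card_gt0P G_edge.
have n0 : (0 < #|vertex G|)%N.
  by have [v _] := ends_nonempty e; apply/card_gt0P; exists v.
(* Without edges the face is empty and [d = -1], so the bound becomes [0 <= n - b - 1]. *)
have [A0|A0] := posnP #|edge (subgraph A)|.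
  have PA0 : magic_polytope R (subgraph A) = set0.
    exact: magic_polytope_edgeless.
  have dimA : has_dim (magic_polytope R (subgraph A)) (-1) by left.
  have dE : d = -1.
    by apply: has_dim_unique dimF _; rewrite FA; apply: has_dim_zero_ext.
  exists A; split=> //; last by rewrite dE.
  have := dim_lker_end_hom_lt R G_edge; rewrite A0 dE bE /n; lia.
have dimA := has_dim_magic R Apos A0.
have dE := has_dim_unique dimF _; rewrite FA in dE.
have {}dE := dE _ (has_dim_zero_ext dimA).
exists A; split=> //; last by rewrite dE.
have vE : #|vertex (subgraph A)| = #|vertex G| by [].
(* Here [d] is the edge count of the subgraph minus [n] plus a kernel dimension that is at least
   [b]; the edge bound follows. *)
have := lker_end_hom_subgraph R A; rewrite dE bE /n vE; lia.
Qed.
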